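(* Let $n\ge2$ and let $X_{A,B,C}$ be a simple (undirected, loopless) quantum graph on $M_n$. Let $k_{AC}$ be the number of connected components of the quantum graph $X_{A,\cdot,C}$ and $k_B$ the number of connected components of the quantum graph $X_{\cdot,B}$. Then $X_{A,B,C}$ has at most $\min(k_{AC},k_B)$ connected components.
   Context: $M_n=M_n(\mathbb C)$, with matrix units $E_{ij}$; ''projector'' means orthogonal projector; $\mathbf 1$ is the all-ones vector. For $A,B,C\in M_n$ with $\operatorname{diag}A=\operatorname{diag}B=\operatorname{diag}C$, $$X_{A,B,C}(x)=\sum_{i\ne j}A_{ij}\,x_{jj}E_{ii}+\sum_{i,j}B_{ij}\,x_{ij}E_{ij}+\sum_{i\neq j}C_{ij}\,x_{ji}E_{ij}.$$ $X_{A,\cdot,C}$ denotes the map obtained by dropping the $B$-sum, and $X_{\cdot,B}$ the map obtained by dropping the $A$- and $C$-sums. A quantum graph on $M_n$ is a linear map $G\colon M_n\to M_n$ with $\sum_{k} G(E_{ik})G(E_{kj})=G(E_{ij})$ for all $i,j$ and $G(x^\dagger)=G(x)^\dagger$; it is undirected if self-adjoint for $\langle x,y\rangle=\mathrm{Tr}(x^\dagger y)$, and loopless if $\sum_k G(E_{ik})E_{kj}=0$ for all $i,j$. (Equivalently for $X_{A,B,C}$: $B$ is a real symmetric projector with $B\mathbf 1=0$, $A_{ij}=A_{ji}$ for $i\neq j$, and $\begin{pmatrix}A_{ij}&C_{ij}\\C_{ji}&A_{ji}\end{pmatrix}$ is a projector for all $i\neq j$.) A quantum graph $G$ has (at least)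 $k$ connected components if there exist non-zero projectors $P_1,\dots,P_k$ on $\mathbb C^n$ with $\sum_sP_s=I$ such that $L_{P_s}\,G\,L_{P_t}=0$ for all $s\ne t$, where $L_P(x)=Px$; the number of connected components is the largest such $k$. *)

(* Defs.v *)
(* The complex field is R[i] for R : realType; Num.conj is its conjugation. *)
From HB Require Import structures.
From mathcomp Require Import all_boot all_order all_algebra.
From mathcomp Require Import boolp reals complex.
Set Implicit Arguments.
Unset Strict Implicit.
Unset Printing Implicit Defensive.
Import Order.TTheory GRing.Theory Num.Theory.
Local Open Scope ring_scope.

Notation adjmx x := (map_mx Num.conj (trmx x)).

Section Maps.
Variables (R : realType) (n : nat).
Notation M := 'M[R[i]]_n.
Implicit Types A B C x : M.

(* delta_mx i j is the matrix unit E_ij. *)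
Definition A_sum A x : M :=
  \sum_i \sum_(j | i != j) (A i j * x j j) *: delta_mx i i.
Definition B_sum B x : M :=
  \sum_i \sum_j (B i j * x i j) *: delta_mx i j.
Definition C_sum C x : M :=
  \sum_i \sum_(j | i != j) (C i j * x j i) *: delta_mx i j.

Definition X_ABC A B C x : M := A_sum A x + B_sum B x + C_sum C x.
Definition X_AC A C x : M := A_sum A x + C_sum C x.
Definition X_B B x : M := B_sum B x.

Fact A_sum_linear A : linear (A_sum A).
Proof.
move=> a x y; rewrite /A_sum scaler_sumr -big_split; apply: eq_bigr => i _ /=.
rewrite scaler_sumr -big_split; apply: eq_bigr => j _ /=.
by rewrite !mxE scalerA -scalerDl mulrDr mulrCA.
Qed.

Fact B_sum_linear B : linear (B_sum B).
Proof.
move=> a x y; rewrite /B_sum scaler_sumr -big_split; apply: eq_bigr => i _ /=.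
rewrite scaler_sumr -big_split; apply: eq_bigr => j _ /=.
by rewrite !mxE scalerA -scalerDl mulrDr mulrCA.
Qed.

Fact C_sum_linear C : linear (C_sum C).
Proof.
move=> a x y; rewrite /C_sum scaler_sumr -big_split; apply: eq_bigr => i _ /=.
rewrite scaler_sumr -big_split; apply: eq_bigr => j _ /=.
by rewrite !mxE scalerA -scalerDl mulrDr mulrCA.
Qed.

Fact X_ABC_linear A B C : linear (X_ABC A B C).
Proof.
move=> a x y; rewrite /X_ABC A_sum_linear B_sum_linear C_sum_linear !scalerDr.
by rewrite [X in X + (_ *: C_sum C x + _)]addrACA [LHS]addrACA.
Qed.

Fact X_AC_linear A C : linear (X_AC A C).
Proof.
by move=> a x y; rewrite /X_AC A_sum_linear C_sum_linear scalerDr addrACA.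
Qed.

HB.instance Definition _ A B C :=
  GRing.isLinear.Build R[i] M M *:%R (X_ABC A B C) (X_ABC_linear A B C).
HB.instance Definition _ A C :=
  GRing.isLinear.Build R[i] M M *:%R (X_AC A C) (X_AC_linear A C).
HB.instance Definition _ B :=
  GRing.isLinear.Build R[i] M M *:%R (X_B B) (B_sum_linear B).

End Maps.

Section QuantumGraphs.
Variables (R : realType) (n : nat).
Notation M := 'M[R[i]]_n.
Implicit Type G : {linear M -> M}.

Definition quantum_graph G : Prop :=
  (forall i j : 'I_n,
     \sum_k G (delta_mx i k) *m G (delta_mx k j) = G (delta_mx i j)) /\
  (forall x : M, G (adjmx x) = adjmx (G x)).

Definition undirected G : Prop :=
  forall x y : M, \tr (adjmx x *m G y) = \tr (adjmx (G x) *m y).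

Definition loopless G : Prop :=
  forall i j : 'I_n, \sum_k G (delta_mx i k) *m delta_mx k j = 0.

Definition simple_quantum_graph G : Prop :=
  [/\ quantum_graph G, undirected G & loopless G].

Definition projector (P : M) : Prop := P *m P = P /\ adjmx P = P.

Definition has_components G (k : nat) : Prop :=
  exists P : 'I_k -> M,
    [/\ forall s, projector (P s),
        forall s, P s != 0,
        \sum_s P s = 1%:M
      & forall s t, s != t -> forall x : M, P s *m G (P t *m x) = 0].

Fact idem_trace (P : M) : P *m P = P -> \tr P = (\rank P)%:R.
Proof.
move=> PP; have := mulmx_base P.
move: (row_base_free P) (col_base_full P).
move: (row_base P) (col_base P) => r c r_free c_full e.
suff rc : r *m c = 1%:M by rewrite -{1}e mxtrace_mulC rc mxtrace1.
apply: (row_free_inj r_free); apply: (row_full_inj c_full).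
by rewrite /= mul1mx !mulmxA e -mulmxA e PP.
Qed.

Fact has_components_le G k : has_components G k -> (k <= n)%N.
Proof.
move=> [P [Pp P0 P1 _]].
have : \tr (\sum_s P s) = n%:R :> R[i] by rewrite P1 mxtrace1.
rewrite raddf_sum /= (eq_bigr (fun s => (\rank (P s))%:R)); last first.
  by move=> s _; apply: idem_trace; case: (Pp s).
rewrite -natr_sum => /eqP; rewrite eqr_nat => /eqP <-.
rewrite -[X in (X <= _)%N]card_ord -sum1_card; apply: leq_sum => s _.
by rewrite lt0n mxrank_eq0.
Qed.

Fact has_components_ex G : exists k, `[< has_components G k >].
Proof.
have [n0|n0] := eqVneq (1%:M : M) 0.
  by exists 0%N; apply/asboolP; exists (fun=> 0); split; try (by case); rewrite big_ord0.
exists 1%N; apply/asboolP; exists (fun=> 1%:M); split => //.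
- by move=> _; split; rewrite ?mulmx1 // trmx1 map_mx1.
- by rewrite big_ord1.
by move=> s t; rewrite !ord1.
Qed.

Fact has_components_bound G k : `[< has_components G k >] -> (k <= n)%N.
Proof. by move/asboolP/has_components_le. Qed.

Definition num_components G : nat :=
  ex_maxn (has_components_ex G) (@has_components_bound G).

End QuantumGraphs.

(* Main.v *)
(* Column b of X_B x depends only on column b of x, while column b of X_AC x
   depends only on the other columns of x.  So each column of either map is a
   column of X_ABC applied to x times a diagonal projector.  Right
   multiplication commutes with the maps x |-> P x, hence a decomposition of
   X_ABC into components is also one of X_AC and of X_B. *)
Require Import Defs.
From mathcomp Require Import all_boot all_order all_algebra.
From mathcomp Require Import boolp reals complex.
Set Implicit Arguments.
Unset Strict Implicit.
Unset Printing Implicit Defensive.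
Import Order.TTheory GRing.Theory Num.Theory.
Local Open Scope ring_scope.

Lemma A_sumE (R : realType) n (A x : 'M[R[i]]_n) p b :
  A_sum A x p b = (\sum_(j | p != j) A p j * x j j) *+ (p == b).
Proof.
rewrite /A_sum summxE (bigD1 p) //= [X in _ + X]big1 => [|i ip].
  rewrite addr0 summxE -sumrMnl; apply: eq_bigr => j _.
  by rewrite !mxE eqxx eq_sym mulr_natr.
rewrite summxE big1 // => j _.
by rewrite !mxE [p == i]eq_sym (negPf ip) mulr0.
Qed.

Lemma B_sumE (R : realType) n (B x : 'M[R[i]]_n) p b :
  B_sum B x p b = B p b * x p b.
Proof.
have -> : B_sum B x = \matrix_(i, j) (B i j * x i j).
  rewrite [RHS]matrix_sum_delta; apply: eq_bigr => i _.
  by apply: eq_bigr => j _; rewrite !mxE.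
by rewrite mxE.
Qed.

Lemma C_sumE (R : realType) n (C x : 'M[R[i]]_n) p b :
  C_sum C x p b = C p b * x b p *+ (p != b).
Proof.
have -> : C_sum C x = \matrix_(i, j) (C i j * x j i *+ (i != j)).
  rewrite [RHS]matrix_sum_delta; apply: eq_bigr => i _.
  rewrite big_mkcond; apply: eq_bigr => j _ /=.
  by rewrite !mxE; case: (i != j); rewrite ?mulr1n ?mulr0n ?scale0r.
by rewrite mxE.
Qed.

Lemma mulmx_delta_diagE (T : pzSemiRingType) m n (x : 'M[T]_(m, n)) b p q :
  (x *m delta_mx b b) p q = x p q *+ (q == b).
Proof.
rewrite mxE (bigD1 b) //= big1 => [|j jb]; last first.
  by rewrite mxE (negPf jb) mulr0.
by rewrite addr0 mxE eqxx mulr_natr; case: eqP => [->|].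
Qed.

(** Right multiplication by [delta_mx b b] erases every column of [x] but column [b]. In column [b]
    of the image, the A-term reads [x j j] with [j != b] and the C-term reads [x b p] with [p != b],
    so both vanish; the B-term reads [x p b], which survives. *)
Lemma col_X_B (R : realType) n (A B C x : 'M[R[i]]_n) b :
  col b (X_B B x) = col b (X_ABC A B C (x *m delta_mx b b)).
Proof.
apply/colP => p; rewrite !mxE A_sumE !B_sumE C_sumE !mulmx_delta_diagE eqxx.
(* The C-term carries both [p == b], from the erased columns, and [p != b], from its own sum, so it
   is 0. *)
rewrite -!mulrnAr -mulrnA mulnb andbN mulr0n mulr0 addr0.
case: eqP => [->|_]; rewrite ?mulr0n ?add0r // big1 ?mul0rn ?add0r // => j bj.
by rewrite mulmx_delta_diagE eq_sym (negPf bj) mulr0.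
Qed.

(** The complementary projector erases column [b] alone: this kills the B-term and leaves the
    entries [x j j] and [x b p] read by the other two intact. *)
Lemma col_X_AC (R : realType) n (A B C x : 'M[R[i]]_n) b :
  col b (X_AC A C x) = col b (X_ABC A B C (x *m (1%:M - delta_mx b b))).
Proof.
have xE p q : (x *m (1%:M - delta_mx b b)) p q = x p q *+ (q != b).
  rewrite mulmxBr mulmx1 mxE [X in _ + X]mxE mulmx_delta_diagE.
  by case: eqP => _; rewrite ?subrr ?subr0.
apply/colP => p; rewrite !mxE !A_sumE B_sumE !C_sumE !xE eqxx mulr0 addr0.
congr (_ + _); last by case: eqP.
case: eqP => // ->; congr (_ *+ _); apply: eq_bigr => j bj.
by rewrite xE eq_sym bj.
Qed.

(** The same projectors serve for [H]: [D] varies with the column but not with [x], so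
    [P t *m x *m D b] is again [P t] times a matrix. *)
Lemma has_components_col (R : realType) n (G H : {linear 'M[R[i]]_n -> 'M[R[i]]_n})
    (D : 'I_n -> 'M[R[i]]_n) k :
  (forall b x, col b (H x) = col b (G (x *m D b))) ->
  has_components G k -> has_components H k.
Proof.
move=> HG [P [Pproj P0 P1 PG]]; exists P; split=> // s t st x.
apply/matrixP => p b.
have : col b (P s *m H (P t *m x)) = 0.
  by rewrite colE -mulmxA -colE HG -mulmxA !colE mulmxA PG // mul0mx.
by move/colP/(_ p); rewrite !mxE.
Qed.

Lemma leq_num_components (R : realType) n
    (G H : {linear 'M[R[i]]_n -> 'M[R[i]]_n}) :
  (forall k, has_components G k -> has_components H k) ->
  (num_components G <= num_components H)%N.
Proof.
move=> GH; rewrite /num_components.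
(* The maximum [k] for [G] is attained, hence also possible for [H], whose maximum is [m]. *)
case: ex_maxnP => k /asboolP Gk _; case: ex_maxnP => m _; apply.
exact/asboolP/GH.
Qed.

Theorem proposition4p5 (R : realType) (n : nat) (hn : (2 <= n)%N)
    (A B C : 'M[R[i]]_n)
    (hAB : forall i : 'I_n, A i i = B i i)
    (hBC : forall i : 'I_n, B i i = C i i)
    (hG : simple_quantum_graph (X_ABC A B C)) :
  (num_components (X_ABC A B C)
     <= minn (num_components (X_AC A C)) (num_components (X_B B)))%N.
Proof.
rewrite leq_min; apply/andP; split; apply: leq_num_components => k.
- by apply: has_components_col => b x; exact: col_X_AC.
- by apply: has_components_col => b x; exact: col_X_B.
Qed.
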